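(* Let $H$ be a finite abelian group, and for each prime $p$ let $H_p$ denote its $p$-Sylow subgroup. Suppose that: (a) for every prime $p\equiv 3\pmod 4$, the group $H_p$ is the square of a group, i.e. $H_p\cong G\times G$ for some group $G$; (b) $H_2$ is isomorphic to $P$ or to $\mathbb{Z}/4\mathbb{Z}\times P$, where $$P\cong \mathbb{Z}/2^{e_1}\mathbb{Z}\times\dots\times\mathbb{Z}/2^{e_{2r}}\mathbb{Z}$$ for some integer $r\ge 0$ (with $P$ trivial if $r=0$) and integers $2\le e_1\le\dots\le e_{2r}$ with $e_{2j}-e_{2j-1}\le 1$ for all $j=1,\dots,r$. Then there exists a ring $A$ of characteristic $0$ such that $A^*\cong \mathbb{Z}/4\mathbb{Z}\times H$.
   Context: Rings are commutative with $1\neq 0$. $A^*$ denotes the multiplicative group of invertible elements of $A$. *)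

(* Defs.v *)
From HB Require Import structures.
From mathcomp Require Import all_boot all_order all_algebra.
From mathcomp Require Import all_fingroup all_solvable.

Set Implicit Arguments.
Unset Strict Implicit.
Unset Printing Implicit Defensive.

Import GRing.Theory.
Local Open Scope ring_scope.

(* The group of invertible elements of a possibly infinite ring; the
   library's {unit R} is only available for finite rings. *)
Section UnitGroup.
Variable R : unitRingType.

Record unit_group := UnitGroup {
  unit_group_val :> R;
  unit_groupP : unit_group_val \is a GRing.unit }.

HB.instance Definition _ := [isSub for unit_group_val].
HB.instance Definition _ := [Choice of unit_group by <:].

Implicit Types u v : unit_group.

Definition unit_group_one := UnitGroup (@unitr1 R).

Fact unit_group_inv_proof u : (val u)^-1 \is a GRing.unit.
Proof. by rewrite unitrV (valP u). Qed.

Definition unit_group_inv u := UnitGroup (unit_group_inv_proof u).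

Fact unit_group_mul_proof u v : val u * val v \is a GRing.unit.
Proof. by rewrite (unitrMr _ (valP u)) (valP v). Qed.

Definition unit_group_mul u v := UnitGroup (unit_group_mul_proof u v).

Fact unit_group_mulA : associative unit_group_mul.
Proof. by move=> u v w; apply/val_inj/mulrA. Qed.

Fact unit_group_mul1 : left_id unit_group_one unit_group_mul.
Proof. by move=> u; apply/val_inj/mul1r. Qed.

Fact unit_group_mulr1 : right_id unit_group_one unit_group_mul.
Proof. by move=> u; apply/val_inj/mulr1. Qed.

Fact unit_group_mulV :
  left_inverse unit_group_one unit_group_inv unit_group_mul.
Proof. by move=> u; apply/val_inj/mulVr/(valP u). Qed.

Fact unit_group_mulrV :
  right_inverse unit_group_one unit_group_inv unit_group_mul.
Proof. by move=> u; apply/val_inj/mulrV/(valP u). Qed.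

HB.instance Definition _ := isGroup.Build unit_group
  unit_group_mulA unit_group_mul1 unit_group_mulr1
  unit_group_mulV unit_group_mulrV.

End UnitGroup.

(* The library's [has_char0 R], i.e. [pchar R] =i pred0, only excludes prime
   characteristics: it holds for 'Z_4, which does not have characteristic 0. *)
Definition char_zero (R : pzRingType) : Prop :=
  forall n : nat, n%:R = 0 :> R -> n = 0%N.

Definition group_isomorphic (G K : groupType) : Prop :=
  exists f : {multiplicative G -> K}, bijective f.

(* The group P, with the exponents numbered from 0: [e i] stands for
   e_(i+1), so e_(2j-1) and e_(2j), j = 1..r, are [e j.*2] and [e j.*2.+1],
   j = 0..r-1.  The group law of 'Z_n is addition; only moduli 2 ^ k with
   k >= 2 occur, for which 'Z_(2 ^ k) is Z/2^kZ. *)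
Definition cyclic_product (r : nat) (e : nat -> nat) : finGroupType :=
  {dffun forall i : 'I_(r.*2), 'Z_(2 ^ e i)}.

(* The truncated subtraction is exact as [e] is nondecreasing. *)
Definition paired_exponents (r : nat) (e : nat -> nat) : Prop :=
  [/\ forall i, (i < r.*2)%N -> (2 <= e i)%N,
      forall i j, (i <= j)%N -> (j < r.*2)%N -> (e i <= e j)%N
    & forall j, (j < r)%N -> (e j.*2.+1 - e j.*2 <= 1)%N].

(* Main.v *)
Require Import Defs.
From HB Require Import structures.
From mathcomp Require Import all_boot all_order all_algebra.
From mathcomp Require Import all_fingroup all_solvable.
From mathcomp Require Import finfield ring zify.

(** An abelian group [M] is a module over the Gaussian integers [Z[i]] as soon
    as it has an endomorphism [J] with [J (J x) = - x]: let [i] act by [J].  The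
    square-zero extension [Z[i] (+) M], in which [M * M = 0], is then a ring of
    characteristic zero.  An element [(a, x)] of it is invertible exactly when
    [a] is, and [(a, x) |-> (a, a^-1 x)] identifies its unit group with
    [Z[i]^* x M], i.e. with [Z/4Z x M] ([sqz_ext_units], [gaussint_units]).

    It remains to find such quarter turns [J], which can be done one primary
    component at a time ([has_turn_pcores]).
    - If [p = 1 %[mod 4]], then [-1] has a square root [k] modulo every power of
      [p], and [J] is multiplication by [k] ([has_turn_pgroup1]).
    - On [G x G], which covers [p = 3 %[mod 4]], take [J (x, y) = (- y, x)]
      ([has_turn_square]).
    - For [p = 2], the quotients of [Z[i]] by the powers of [1 + i] are the
      groups [Z/2^a x Z/2^b] with [a <= b <= a + 1], so the product of the two
      factors of [P] with exponents [e_(2j-1)] and [e_(2j)] has a quarter turn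
      for each [j] ([has_turn_cyclic_product]).

    This settles the case where the Sylow 2-subgroup of [H] is [P].  If it is
    [Z/4Z x P] instead, then [H] is [Z/4Z x K] where [K] has a quarter turn, and
    the extra factor [Z/4Z] is the unit group of a second copy of [Z[i]]: the
    product of [Z[i] (+) K] with [Z[i]] has the required units
    ([realization_with_Z4]). *)

Set Implicit Arguments.
Unset Strict Implicit.
Unset Printing Implicit Defensive.

Import GRing.Theory Num.Theory.

(** * Isomorphisms of groups and characteristic zero *)

Section GroupIsomorphic.
Local Open Scope group_scope.

Lemma group_isomorphic_of (G K : groupType) (f : G -> K) :
  {morph f : x y / x * y} -> bijective f -> group_isomorphic G K.
Proof.
move=> fM fbij.
pose F : {multiplicative G -> K} := HB.pack f (isMultiplicative.Build G K f fM).
by exists F.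
Qed.

Lemma group_isomorphic_sym (G K : groupType) :
  group_isomorphic G K -> group_isomorphic K G.
Proof.
case=> f [g fK gK]; apply: (@group_isomorphic_of _ _ g); last by exists f.
exact: can2_gmulfM fK gK.
Qed.

Lemma group_isomorphic_trans (G K L : groupType) :
  group_isomorphic G K -> group_isomorphic K L -> group_isomorphic G L.
Proof.
case=> f bij_f [g bij_g]; apply: (@group_isomorphic_of _ _ (g \o f)).
  by move=> x y /=; rewrite !gmulfM.
exact: bij_comp.
Qed.

Lemma group_isomorphic_prod (G K G' K' : groupType) :
  group_isomorphic G G' -> group_isomorphic K K' ->
  group_isomorphic (G * K)%type (G' * K')%type.
Proof.
case=> f [f' fK f'K] [g [g' gK g'K]].
apply: (@group_isomorphic_of _ _ (fun u => (f u.1, g u.2))).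
  by move=> x y; congr pair; rewrite /= gmulfM.
by exists (fun u => (f' u.1, g' u.2)) => -[x y] /=; rewrite ?fK ?gK ?f'K ?g'K.
Qed.

Lemma group_isomorphic_prodA (G K L : groupType) :
  group_isomorphic (G * K * L)%type (G * (K * L))%type.
Proof.
apply: (@group_isomorphic_of _ _ (fun u => (u.1.1, (u.1.2, u.2)))) => //.
by exists (fun u => ((u.1, u.2.1), u.2.2)) => [[[]]|[? []]].
Qed.

Lemma group_isomorphic_prodC (G K : groupType) :
  group_isomorphic (G * K)%type (K * G)%type.
Proof.
apply: (@group_isomorphic_of _ _ (fun u => (u.2, u.1))) => //.
by exists (fun u => (u.2, u.1)) => -[].
Qed.

Lemma isog_group_isomorphic (G K : finGroupType) :
  [set: G] \isog [set: K] -> group_isomorphic G K.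
Proof.
case/isogP=> f injf imf; apply: (@group_isomorphic_of _ _ f).
  by move=> x y; rewrite morphM ?inE.
apply: inj_card_bij; first by move=> x y /(injmP injf)->; rewrite ?inE.
by rewrite -!cardsT -imf card_injm.
Qed.

End GroupIsomorphic.

Lemma char_zero_additive (R S : pzRingType) (f : {additive R -> S}) :
  f 1%R = 1%R -> char_zero S -> char_zero R.
Proof.
by move=> f1 S0 n /(congr1 f); rewrite raddfMn f1 raddf0 => /S0.
Qed.

(** * Gaussian integers *)

Section GaussInt.
Local Open Scope ring_scope.

(** The pair [(a, b)] is [a + b i].  Only the additive structure is copied from
    the product, whose componentwise multiplication is a different one. *)
Definition gaussint : Type := (int * int)%type.
HB.instance Definition _ := GRing.Zmodule.copy gaussint (int * int)%type.

Definition gauss_mul (z w : gaussint) : gaussint :=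
  (z.1 * w.1 - z.2 * w.2, z.1 * w.2 + z.2 * w.1).

Fact gauss_mulA : associative gauss_mul.
Proof. by move=> [a b] [c d] [e f]; congr pair => /=; ring. Qed.
Fact gauss_mulC : commutative gauss_mul.
Proof. by move=> [a b] [c d]; congr pair => /=; ring. Qed.
Fact gauss_mul1 : left_id ((1, 0) : gaussint) gauss_mul.
Proof. by move=> [a b]; congr pair => /=; ring. Qed.
Fact gauss_mulDl : left_distributive gauss_mul +%R.
Proof. by move=> [a b] [c d] [e f]; congr pair => /=; ring. Qed.
Fact gauss_oner_neq0 : ((1, 0) : gaussint) != 0.
Proof. by []. Qed.

HB.instance Definition _ := GRing.Zmodule_isComNzRing.Build gaussint
  gauss_mulA gauss_mulC gauss_mul1 gauss_mulDl gauss_oner_neq0.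

Definition gauss_norm (z : gaussint) : int := z.1 ^+ 2 + z.2 ^+ 2.
Definition gauss_conj (z : gaussint) : gaussint := (z.1, - z.2).
Definition gauss_unit : pred gaussint := fun z => gauss_norm z == 1.
Definition gauss_inv (z : gaussint) : gaussint :=
  if gauss_norm z == 1 then gauss_conj z else z.

Lemma gauss_normM (z w : gaussint) :
  gauss_norm (z * w) = gauss_norm z * gauss_norm w.
Proof. by case: z w => [a b] [c d]; rewrite /gauss_norm /=; ring. Qed.

Fact gauss_mulVz : {in gauss_unit, left_inverse 1 gauss_inv *%R}.
Proof.
move=> [a b]; rewrite unfold_in /gauss_unit /gauss_inv => nz; rewrite nz.
by move/eqP: nz; rewrite /gauss_norm /= => nz; congr pair; rewrite /=;
  [rewrite -nz|]; ring.
Qed.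

Fact gauss_unitPl (z w : gaussint) : w * z = 1 -> gauss_unit z.
Proof.
move=> wz1; rewrite /gauss_unit; apply/eqP.
have: gauss_norm w * gauss_norm z = 1 by rewrite -gauss_normM wz1.
have: 0 <= gauss_norm w by rewrite addr_ge0 ?sqr_ge0.
have: 0 <= gauss_norm z by rewrite addr_ge0 ?sqr_ge0.
move: (gauss_norm z) (gauss_norm w) => [m|//] [n|//] _ _ [].
by move/eqP; rewrite muln_eq1 => /andP[_ /eqP->].
Qed.

Fact gauss_inv_out : {in [predC gauss_unit], gauss_inv =1 id}.
Proof. by move=> z; rewrite inE unfold_in /gauss_inv => /negPf->. Qed.

HB.instance Definition _ := GRing.ComNzRing_hasMulInverse.Build gaussint
  gauss_mulVz gauss_unitPl gauss_inv_out.

End GaussInt.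

Section GaussUnits.
Local Open Scope ring_scope.

Definition gauss_i : gaussint := (0, 1).

(** The equation [a ^ 2 + b ^ 2 = 1] confines both coordinates to [-1, 0, 1]. *)
Lemma gauss_unit_enum (z : gaussint) :
  z \is a GRing.unit -> z \in [:: 1; gauss_i; gauss_i ^+ 2; gauss_i ^+ 3].
Proof.
case: z => a b /eqP; rewrite /gauss_norm /= => nz.
have: [\/ a = 1 /\ b = 0, a = 0 /\ b = 1,
          a = -1 /\ b = 0 | a = 0 /\ b = -1].
  have le1 (m n : int) : m ^+ 2 + n ^+ 2 = 1 -> -1 <= m <= 1.
    by have := sqr_ge0 n; rewrite expr2 => ??; nia.
  have := le1 a b nz; have := le1 b a; rewrite addrC => /(_ nz).
  rewrite !expr2 in nz; move=> ??.
  have [a1|[a1|a1]] : a = -1 \/ a = 0 \/ a = 1 by lia.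
  - by constructor 3; split=> //; nia.
  - have [b1|[b1|b1]] : b = -1 \/ b = 0 \/ b = 1 by lia.
    + by constructor 4.
    + by rewrite a1 b1 in nz.
    + by constructor 2.
  - by constructor 1; split=> //; nia.
by case=> -[-> ->].
Qed.

Lemma gauss_i_unit : gauss_i \is a GRing.unit.
Proof. by []. Qed.

Lemma gauss_i4 : gauss_i ^+ 4 = 1.
Proof. by apply/eqP. Qed.

Lemma gaussint_units : group_isomorphic (unit_group gaussint) 'Z_4.
Proof.
apply: group_isomorphic_sym.
pose f (k : 'Z_4) := UnitGroup (unitrX k gauss_i_unit).
apply: (@group_isomorphic_of _ _ f).
  by move=> k l; apply: val_inj; rewrite /= -exprD (expr_mod _ gauss_i4).
have injf : injective f.
  by case=> [[|[|[|[|//]]]] ltk] [[|[|[|[|//]]]] ltl] /(congr1 val)/eqP //= _;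
  apply: val_inj.
have surjf u : exists k, f k == u.
  have := gauss_unit_enum (valP u); rewrite !inE.
  case/or4P => /eqP def_u; [exists 0|exists 1|exists 2%:R|exists 3%:R];
    exact/eqP/val_inj/esym/def_u.
exists (fun u => xchoose (surjf u)) => [k|u].
  exact/injf/eqP/(xchooseP (surjf (f k))).
exact/eqP/(xchooseP (surjf u)).
Qed.

Lemma gaussint_char_zero : char_zero gaussint.
Proof.
apply: (@char_zero_additive gaussint int fst) => // n.
by move=> /eqP; rewrite pnatr_eq0 => /eqP.
Qed.

End GaussUnits.

(** * Square-zero extensions *)

Section SquareZeroExtension.
Local Open Scope ring_scope.
Variables (R : comUnitRingType) (M : lmodType R).

Definition sqz_ext : Type := (R * M)%type.
HB.instance Definition _ := GRing.Zmodule.copy sqz_ext (R * M)%type.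

Implicit Types u v w : sqz_ext.

Definition sqz_mul u v : sqz_ext := (u.1 * v.1, u.1 *: v.2 + v.1 *: u.2).

Fact sqz_mulA : associative sqz_mul.
Proof.
move=> [a x] [b y] [c z]; congr pair => /=; first exact: mulrA.
by rewrite !scalerDr !scalerA addrA [c * a]mulrC [c * b]mulrC.
Qed.
Fact sqz_mulC : commutative sqz_mul.
Proof. by move=> [a x] [b y]; congr pair => /=; rewrite (mulrC, addrC). Qed.
Fact sqz_mul1 : left_id ((1, 0) : sqz_ext) sqz_mul.
Proof.
by move=> [a x]; congr pair => /=; rewrite ?mul1r // scale1r scaler0 addr0.
Qed.
Fact sqz_mulDl : left_distributive sqz_mul +%R.
Proof.
move=> [a x] [b y] [c z]; congr pair => /=; first exact: mulrDl.
by rewrite scalerDl scalerDr addrACA.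
Qed.
Fact sqz_oner_neq0 : ((1, 0) : sqz_ext) != 0.
Proof. by apply/eqP => -[/eqP]; rewrite oner_eq0. Qed.

HB.instance Definition _ := GRing.Zmodule_isComNzRing.Build sqz_ext
  sqz_mulA sqz_mulC sqz_mul1 sqz_mulDl sqz_oner_neq0.

Definition sqz_unit : pred sqz_ext := fun u => u.1 \is a GRing.unit.
Definition sqz_inv u : sqz_ext :=
  if sqz_unit u then (u.1^-1, - (u.1^-1 ^+ 2 *: u.2)) else u.

Fact sqz_mulVu : {in sqz_unit, left_inverse 1 sqz_inv *%R}.
Proof.
move=> u uU; rewrite /sqz_inv [sqz_unit u]uU; rewrite unfold_in in uU.
congr pair => /=; first exact: mulVr.
by rewrite scalerN scalerA expr2 mulrA mulrV // mul1r subrr.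
Qed.

Fact sqz_unitPl u v : v * u = 1 -> sqz_unit u.
Proof. by case=> vu1 _; apply/unitrPr; exists v.1; rewrite mulrC. Qed.

Fact sqz_inv_out : {in [predC sqz_unit], sqz_inv =1 id}.
Proof. by move=> u /negPf uN; rewrite /sqz_inv [sqz_unit u]uN. Qed.

HB.instance Definition _ := GRing.ComNzRing_hasMulInverse.Build sqz_ext
  sqz_mulVu sqz_unitPl sqz_inv_out.

(** The unit [(a, x)] factors as [(a, 0) * (1, a^-1 x)], and the elements
    [(1, y)] multiply as the vectors [y] add.  The multiplicative group [K]
    stands for the additive group of [M]. *)
Lemma sqz_ext_units (K : groupType) (phi : M -> K) :
  {morph phi : x y / x + y >-> (x * y)%g} -> bijective phi ->
  group_isomorphic (unit_group sqz_ext) (unit_group R * K)%type.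
Proof.
move=> phiD [psi phiK psiK].
pose f (u : unit_group sqz_ext) : unit_group R * K :=
  (UnitGroup (valP u : (val u).1 \is a GRing.unit),
   phi ((val u).1^-1 *: (val u).2)).
apply: (@group_isomorphic_of _ _ f).
  move=> [[a x] aU] [[b y] bU]; congr pair; first exact: val_inj.
  have aU' : a \is a GRing.unit := aU.
  have bU' : b \is a GRing.unit := bU.
  rewrite -phiD /= scalerDr !scalerA invrM // mulrVK // mulrAC mulVr //.
  by rewrite mul1r addrC.
have gU (w : unit_group R * K) :
  ((val w.1, val w.1 *: psi w.2) : sqz_ext) \is a GRing.unit := valP w.1.
pose g (w : unit_group R * K) : unit_group sqz_ext := UnitGroup (gU w).
exists g => [[[a x] aU]|[[a aU] k]].
  by apply: val_inj; congr pair; rewrite /= phiK scalerA mulrV ?scale1r.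
congr pair; first exact: val_inj.
by rewrite /= scalerA mulVr // scale1r psiK.
Qed.

Lemma sqz_ext_char_zero : char_zero R -> char_zero sqz_ext.
Proof. exact: (@char_zero_additive sqz_ext R fst). Qed.

End SquareZeroExtension.

(** * Products of rings *)

Section ProductRing.
Variables R S : comUnitRingType.

Lemma prod_units :
  group_isomorphic (unit_group (R * S)%type)
                   (unit_group R * unit_group S)%type.
Proof.
pose f (u : unit_group (R * S)%type) : unit_group R * unit_group S :=
  (UnitGroup (andP (valP u)).1, UnitGroup (andP (valP u)).2).
have gU (w : unit_group R * unit_group S) :
    ((val w.1, val w.2) : R * S) \is a GRing.unit.
  by apply/andP; split; apply: valP.
apply: (@group_isomorphic_of _ _ f).
  by move=> u v; congr pair; apply: val_inj.
pose g w : unit_group (R * S)%type := UnitGroup (gU w).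
exists g => [u|w].
  by apply: val_inj; rewrite /=; case: (val u).
by case: w => a b; congr pair; apply: val_inj.
Qed.

Lemma prod_char_zero : char_zero R -> char_zero (R * S)%type.
Proof. exact: (@char_zero_additive (R * S)%type R fst). Qed.

End ProductRing.

(** * Modules over the Gaussian integers from quarter turns *)

Section QuarterTurn.
Local Open Scope group_scope.

(** In additive notation, [turn] is a square root of [-1] in the endomorphism
    ring of the group, i.e. the action of [i] for a structure of
    [Z[i]]-module. *)
Record turned_group := TurnedGroup {
  turned_group_sort :> groupType;
  turned_groupC : forall x y : turned_group_sort, x * y = y * x;
  turn : turned_group_sort -> turned_group_sort;
  turnM : {morph turn : x y / x * y};
  turnK : forall x, turn (turn x) = x^-1 }.

Variable G : turned_group.

(** The group [G] itself, but with its law written additively. *)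
Definition turn_module : Type := G.
HB.instance Definition _ := Choice.copy turn_module G.

Let mulgC : commutative (@mul G) := @turned_groupC G.
HB.instance Definition _ := GRing.isZmodule.Build turn_module
  (@mulgA G) mulgC (@mul1g G) (@mulVg G).

Local Open Scope ring_scope.

Definition turn_add : turn_module -> turn_module := @turn G.

Fact turn_addB : {morph turn_add : x y / x - y}.
Proof.
have turnD : {morph turn_add : x y / x + y} by exact: turnM.
have turn0 : turn_add 0 = 0.
  by apply: (addrI (turn_add 0)); rewrite -turnD !addr0.
move=> x y; rewrite turnD; congr (_ + _); apply: (addrI (turn_add y)).
by rewrite -turnD !subrr.
Qed.
HB.instance Definition _ :=
  GRing.isZmodMorphism.Build turn_module turn_module turn_add turn_addB.

Fact turn_addK x : turn_add (turn_add x) = - x.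
Proof. exact: turnK. Qed.

Definition gauss_scale (z : gaussint) (x : turn_module) : turn_module :=
  x *~ z.1 + turn_add x *~ z.2.

Fact gauss_scaleA z w x :
  gauss_scale z (gauss_scale w x) = gauss_scale (z * w) x.
Proof.
have turnD a b : turn_add (a + b) = turn_add a + turn_add b.
  exact: raddfD turn_add a b.
have turnMz a n : turn_add (a *~ n) = turn_add a *~ n.
  exact: raddfMz turn_add n a.
rewrite /gauss_scale turnD !turnMz turn_addK /= !mulrzDl !mulrzDr.
rewrite !mulNrz mulrNz -!mulrzA ![w.1 * _]mulrC ![w.2 * _]mulrC.
by rewrite [X in _ + X = _]addrC addrACA.
Qed.

Fact gauss_scale1 : left_id 1 gauss_scale.
Proof. by move=> x; rewrite /gauss_scale mulr1z mulr0z addr0. Qed.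

Fact gauss_scaleDr : right_distributive gauss_scale +%R.
Proof. by move=> z x y; rewrite /gauss_scale raddfD !mulrzDl addrACA. Qed.

Fact gauss_scaleDl x : {morph gauss_scale^~ x : z w / z + w}.
Proof. by move=> z w; rewrite /gauss_scale !mulrzDr addrACA. Qed.

HB.instance Definition _ := GRing.Zmodule_isLmodule.Build gaussint turn_module
  gauss_scaleA gauss_scale1 gauss_scaleDr gauss_scaleDl.

Lemma turned_group_realization :
  exists A : comUnitRingType,
    char_zero A /\ group_isomorphic (unit_group A) ('Z_4 * G)%type.
Proof.
exists (sqz_ext turn_module); split.
  exact/sqz_ext_char_zero/gaussint_char_zero.
have Gid := @sqz_ext_units _ turn_module G id (fun _ _ => erefl).
apply: (group_isomorphic_trans (Gid _)); first by exists id.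
apply: group_isomorphic_prod; first exact: gaussint_units.
by apply: (@group_isomorphic_of _ _ id) => //; exists id.
Qed.

End QuarterTurn.

(** * Square roots of -1 modulo prime powers *)

Section SqrtNeg1.
Local Open Scope ring_scope.

(** Write [p = 4 * t + 1].  By Fermat every nonzero [x] of ['F_p] satisfies
    [x ^ (2 * t) = 1] or [x ^ (2 * t) = -1].  The first equation has at most
    [2 * t] of the [4 * t] nonzero elements as solutions, so the second one has
    a solution [x], and then [x ^ t] is a square root of [-1]. *)
Lemma sqrt_neg1_mod_prime p : prime p -> (p = 1 %[mod 4])%N ->
  exists k : nat, (p %| k ^ 2 + 1)%N.
Proof.
move=> pr_p p1; pose t := (p %/ 4)%N.
have pt : p = (4 * t).+1 by rewrite /t; lia.
have t_gt0 : (0 < t)%N by have := prime_gt1 pr_p; lia.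
have [x xN] : exists x : 'F_p, x ^+ (2 * t) = -1.
  suffices /existsP[x /eqP] : [exists x : 'F_p, x ^+ (2 * t) == -1].
    by exists x.
  apply: contraT => /existsPn noN.
  pose P : {poly 'F_p} := 'X^(2 * t) - 1%:P.
  have sP : size P = (2 * t).+1 by rewrite size_XnsubC ?muln_gt0.
  pose s := enum (predC1 (0 : 'F_p)).
  have rootP x : x \in s -> root P x.
    rewrite mem_enum => x0.
    have: (x ^+ (2 * t)) ^+ 2 = 1.
      rewrite -exprM; apply: (mulfI x0); rewrite mulr1 -exprS.
      have -> : (2 * t * 2).+1 = #|'F_p| by rewrite card_Fp //; lia.
      exact: expf_card.
    move/eqP; rewrite sqrf_eq1 (negPf (noN x)) orbF => /eqP x1.
    by rewrite /root !hornerE x1 subrr.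
  have := @max_poly_roots _ P s.
  rewrite -size_poly_eq0 sP => /(_ isT) /(_ (introT allP rootP)).
  by move=> /(_ (enum_uniq _)); rewrite -cardE cardC1 card_Fp //; lia.
exists (x ^+ t : 'F_p).
rewrite (dvdn_pcharf (pchar_Fp pr_p)) natrD natrX natr_Zp -exprM mulnC xN.
by rewrite addNr.
Qed.

(** In the factorization [x ^ p + 1 = (x + 1) * S], each of the [p] terms of
    [S] is [1] modulo [p], because [x] is [-1] and [p] is odd; so [S]
    contributes one more factor [p]. *)
Lemma dvdn_expS_add1 p n x : prime p -> odd p ->
  (p ^ n.+1 %| x + 1 -> p ^ n.+2 %| x ^ p + 1)%N.
Proof.
move=> pr_p odd_p dvd_x.
pose S : int := \sum_(i < p) x%:Z ^+ (p.-1 - i) * (-1) ^+ i.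
have fact : (x ^ p + 1)%N%:Z = (x + 1)%N%:Z * S.
  have := subrXX x%:Z (-1) p; rewrite -signr_odd odd_p expr1 !opprK /S => <-.
  by rewrite PoszD -natz natrX natz.
have dvd_S : (p%:Z %| S)%Z.
  rewrite (dvdz_pcharf (pchar_Fp pr_p)) /S.
  have xN : x%:R = -1 :> 'F_p.
    apply/eqP; rewrite -addr_eq0 -[1]/(1%:R) -natrD.
    rewrite -(dvdn_pcharf (pchar_Fp pr_p)).
    by apply: dvdn_trans dvd_x; rewrite dvdn_exp.
  rewrite rmorph_sum /= (eq_bigr (fun _ => 1)) => [|i _].
    by rewrite sumr_const card_ord (pcharf0 (pchar_Fp pr_p)).
  rewrite rmorphM !rmorphXn rmorphN1 /= [x%:~R]xN -exprD.
  have -> : (p.-1 - i + i = p.-1)%N by have := ltn_ord i; lia.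
  by rewrite -signr_odd; have -> : odd p.-1 = false by lia.
have: ((p ^ n.+2)%N%:Z %| (x ^ p + 1)%N%:Z)%Z.
  by rewrite fact expnSr PoszM dvdz_mul.
by [].
Qed.

(** If [k ^ 2] is [-1] modulo [p ^ n], then [(k ^ p) ^ 2 = (k ^ 2) ^ p] is [-1]
    modulo the next power of [p]: raising to the power [p] replaces Hensel
    lifting. *)
Lemma sqrt_neg1_mod_prime_power p n : prime p -> (p = 1 %[mod 4])%N ->
  exists k : nat, (p ^ n %| k ^ 2 + 1)%N.
Proof.
move=> pr_p p1; elim: n => [|[|n] IHn].
- by exists 0%N; rewrite dvd1n.
- exact: sqrt_neg1_mod_prime.
have [k k2] := IHn; exists (k ^ p)%N.
rewrite -expnM mulnC expnM dvdn_expS_add1 //.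
by lia.
Qed.

End SqrtNeg1.

(** * Construction of quarter turns on finite groups *)

Section HasTurn.
Local Open Scope group_scope.

(** The counterpart of [turned_group] for subsets of a finite group, where Sylow
    subgroups live. *)
Definition has_turn (gT : finGroupType) (K : {set gT}) : Prop :=
  exists J : gT -> gT,
    [/\ {in K &, {morph J : x y / x * y}}, {in K, forall x, J x \in K}
      & {in K, forall x, J (J x) = x^-1}].

Lemma has_turn1 (gT : finGroupType) : has_turn [1 gT].
Proof.
by exists id; split=> // x; rewrite inE => /eqP->; rewrite invg1.
Qed.

Lemma has_turn_isog (gT rT : finGroupType) (K : {group gT}) (L : {group rT}) :
  K \isog L -> has_turn L -> has_turn K.
Proof.
case/isogP=> f injf imf [J [JM JL JK]].
pose g := invm injf.
have fL x : x \in K -> f x \in L by move=> Kx; rewrite -imf mem_morphim.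
have gK y : y \in L -> g y \in K.
  rewrite -imf => Ly.
  by have := mem_morphim (invm_morphism injf) Ly Ly; rewrite im_invm.
have fgK y : y \in L -> f (g y) = y by rewrite -imf; apply: invmK.
exists (fun x => g (J (f x))); split=> [x y Kx Ky|x Kx|x Kx].
- by rewrite morphM // JM ?fL // /g morphM // imf JL ?fL.
- exact/gK/JL/fL.
- rewrite fgK ?JL ?fL // JK ?fL // -morphV //.
  by rewrite /g invmE ?groupV.
Qed.

Lemma has_turn_dprod (gT : finGroupType) (A B : {group gT}) (G : {group gT}) :
  A \x B = G -> has_turn A -> has_turn B -> has_turn G.
Proof.
move=> defG [J [JM JA JK]] [J' [J'M J'B J'K]].
have [_ mulAB cAB tiAB] := dprodP defG.
have trivA a b : a \in A -> b \in B -> divgr A B (a * b) = a.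
  exact: divgrMid.
have trivB a b : a \in A -> b \in B -> remgr A B (a * b) = b.
  exact: remgrMid.
exists (fun x => J (divgr A B x) * J' (remgr A B x)).
have GP x : x \in G -> exists a b, [/\ a \in A, b \in B & x = a * b].
  by rewrite -mulAB => /mulsgP[a b Aa Bb ->]; exists a, b.
have comm a b : a \in A -> b \in B -> commute a b.
  by move=> Aa Bb; apply/commute_sym; apply: (centsP cAB).
split=> [x y|x|x].
- move=> /GP[a [b [Aa Bb ->]]] /GP[c [d [Ac Bd ->]]].
  have -> : a * b * (c * d) = (a * c) * (b * d).
    by rewrite !mulgA -(mulgA a b) -(comm c b) // !mulgA.
  rewrite !trivA ?trivB ?groupM // JM // J'M //.
  by rewrite !mulgA -(mulgA (J a) (J c)) (comm (J c)) ?JA ?J'B // !mulgA.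
- move=> /GP[a [b [Aa Bb ->]]].
  by rewrite trivA // trivB // -mulAB mem_mulg ?JA ?J'B.
- move=> /GP[a [b [Aa Bb ->]]]; rewrite !(trivA, trivB) ?JA ?J'B //.
  by rewrite JK // J'K // invMg (comm a^-1) ?groupV.
Qed.

Lemma has_turn_pcore_p'core (gT : finGroupType) (G : {group gT}) p :
  (forall q, prime q -> q != p -> has_turn 'O_q(G)) ->
  forall q, prime q -> has_turn 'O_q('O_p^'(G)).
Proof.
move=> turnO q pr_q; have [->|neq_qp] := eqVneq q p.
  suffices -> : 'O_p('O_p^'(G)) = 1 by exact: has_turn1.
  apply/card1_trivg/(@pnat_1 p); first exact: pcore_pgroup.
  exact: pgroupS (pcore_sub _ _) (pcore_pgroup _ _).
rewrite -pcoreI (@eq_pcore _ _ q); first exact: turnO.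
by move=> x; rewrite !inE; case: eqVneq => // ->.
Qed.

(** By induction on the order, splitting off one primary component at a time:
    the primary components of the complement ['O_p^'(G)] are those of [G] at the
    other primes. *)
Lemma has_turn_pcores (gT : finGroupType) (G : {group gT}) :
  nilpotent G -> (forall p, prime p -> has_turn 'O_p(G)) -> has_turn G.
Proof.
have [n] := ubnP #|G|; elim: n G => // n IHn G; rewrite ltnS => leGn nilG turnO.
have [->|ntG] := eqsVneq G 1; first exact: has_turn1.
pose p := pdiv #|G|; have pr_p : prime p by rewrite pdiv_prime ?cardG_gt1.
have defG := nilpotent_pcoreC p nilG.
apply: (has_turn_dprod defG); first exact: turnO.
apply: IHn; last by apply: has_turn_pcore_p'core => q pr_q _; apply: turnO.
  apply: leq_trans leGn; rewrite -(dprod_card defG) ltn_Pmull ?cardG_gt0 //.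
  rewrite (card_Hall (nilpotent_pcore_Hall p nilG)) p_part -(expn0 p).
  by rewrite ltn_exp2l ?prime_gt1 // logn_gt0 pi_pdiv cardG_gt1.
exact: nilpotentS (pcore_sub _ _) nilG.
Qed.

Lemma has_turn_pgroup1 (gT : finGroupType) (K : {group gT}) p :
  prime p -> p = 1 %[mod 4] -> p.-group K -> abelian K -> has_turn K.
Proof.
move=> pr_p p1 pK cKK.
have [n oK] := p_natP pK.
have [k /dvdnP[c k2]] := sqrt_neg1_mod_prime_power n pr_p p1.
exists (fun x => x ^+ k); split=> [x y Kx Ky|x Kx|x Kx].
- by rewrite expgMn //; apply: (centsP cKK).
- exact: groupX.
apply/eqP; rewrite -expgM mulnn eq_sym eq_invg_mul -expgS -addn1 k2 -oK mulnC.
by rewrite expgM expg_cardG // expg1n.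
Qed.

Lemma has_turn_square (G : finGroupType) :
  abelian [set: G] -> has_turn [set: (G * G)%type].
Proof.
move=> cG; have comm (x y : G) : commute x y by apply: (centsP cG); rewrite inE.
exists (fun u => (u.2^-1, u.1)).
split=> [[a b] [c d] _ _|u _|//]; last by rewrite inE.
by congr pair; rewrite /= invMg comm.
Qed.

Lemma has_turn_prod (G K : finGroupType) :
  has_turn [set: G] -> has_turn [set: K] -> has_turn [set: (G * K)%type].
Proof.
case=> J [JM _ JK] [J' [J'M _ J'K]].
exists (fun u => (J u.1, J' u.2)); split=> [x y _ _|x _|x _]; last 1 first.
- by congr pair; rewrite /= ?JK ?J'K ?inE.
- by congr pair; rewrite /= ?JM ?J'M ?inE.
- by rewrite inE.
Qed.

End HasTurn.

(** * The quarter turn on a product of paired cyclic 2-groups *)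

Section CyclicProduct.
Local Open Scope ring_scope.

(** The additive map from ['Z_m] to ['Z_n] that sends [1] to [c]; it is well
    defined, hence additive, when [n] divides [c * m]. *)
Definition rescale c m n (x : 'Z_m) : 'Z_n := (c * x)%:R.

Lemma rescale_nat c m n k : (1 < m)%N -> (1 < n)%N -> (n %| c * m)%N ->
  rescale c n (k%:R : 'Z_m) = (c * k)%:R.
Proof.
move=> m_gt1 n_gt1 n_cm; rewrite /rescale val_Zp_nat //.
apply: val_inj; rewrite /= !val_Zp_nat // {2}(divn_eq k m) mulnDr mulnCA.
by rewrite -modnDml (eqP (dvdn_mull _ n_cm)) add0n.
Qed.

Lemma rescaleD c m n : (1 < m)%N -> (1 < n)%N -> (n %| c * m)%N ->
  {morph @rescale c m n : x y / x + y}.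
Proof.
move=> m_gt1 n_gt1 n_cm x y; rewrite -{1}(natr_Zp x) -{1}(natr_Zp y) -natrD.
by rewrite rescale_nat // mulnDr natrD.
Qed.

Lemma rescaleN c m n : (1 < m)%N -> (1 < n)%N -> (n %| c * m)%N ->
  {morph @rescale c m n : x / - x}.
Proof.
move=> m_gt1 n_gt1 n_cm x; apply: (addIr (rescale c n x)).
by rewrite -rescaleD // !addNr /rescale muln0.
Qed.

Lemma rescaleK c d m n (x : 'Z_m) : (1 < m)%N -> (1 < n)%N -> (m %| c * n)%N ->
  rescale c m (rescale d n x) = x *+ (c * d).
Proof.
move=> m_gt1 n_gt1 m_cn.
by rewrite rescale_nat // mulnA mulnC natrM natr_Zp mulr_natr.
Qed.

(** For [b = a] or [b = a + 1], the quotient of [Z[i]] by [2 ^ a], respectively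
    by [2 ^ a * (1 + i)], is [Z/2^a x Z/2^b], with generators [1 + i] and [1].
    As [i * (1 + i)] is [(1 + i) - 2] and [i * 1] is [(1 + i) - 1],
    multiplication by [i] is [(x, y) |-> (x + y, - (y + 2 x))].  The
    inequalities [a <= b <= a + 1] are just what makes [y] modulo [2 ^ a] and
    [2 x] modulo [2 ^ b] meaningful. *)
Lemma has_turn_cyclic_product r e :
  paired_exponents r e -> has_turn [set: cyclic_product r e].
Proof.
case=> e_ge2 e_incr e_pair.
(* [mate] exchanges the two indices [2j] and [2j + 1] of a pair, and [J] maps
   the coordinate at [i] to [s i * (f i + c i * f (mate i))]. *)
have lt_mate (i : 'I_(r.*2)) : ((if odd i then i.-1 else i.+1) < r.*2)%N.
  by have := ltn_ord i; case: ifP => oi; lia.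
pose mate i := Ordinal (lt_mate i).
have odd_mate i : odd (mate i) = ~~ odd i by rewrite /=; case: ifP => oi; lia.
have mateK : involutive mate.
  move=> i; apply: val_inj; have := odd_mate i; rewrite /=.
  by case oi: (odd i) => /= ->; lia.
pose c (i : 'I_(r.*2)) := (odd i).+1.
have e_gt1 (i : 'I_(r.*2)) : (1 < 2 ^ e i)%N.
  by rewrite -(expn0 2) ltn_exp2l // (leq_trans _ (e_ge2 _ (ltn_ord i))).
have dvd_c (i : 'I_(r.*2)) : (2 ^ e i %| c i * 2 ^ e (mate i))%N.
  have -> : c i = (2 ^ odd i)%N by rewrite /c; case: (odd i).
  rewrite -expnD dvdn_exp2l //=; have lt_i := ltn_ord i.
  have := lt_mate i; case: ifP => oi lt_m /=; last by rewrite e_incr.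
  have /e_pair : (i./2 < r)%N by lia.
  have -> : (i./2).*2 = i.-1 by lia.
  by rewrite prednK; lia.
pose s (i : 'I_(r.*2)) : 'Z_(2 ^ e i) := (-1) ^+ odd i.
pose J (f : cyclic_product r e) : cyclic_product r e :=
  [ffun i => s i * (f i + rescale (c i) (2 ^ e i) (f (mate i)))].
exists J; split=> [f g _ _|f _|f _]; last 1 first.
- apply/ffunP => i; rewrite !ffunE.
  have signE x : rescale (c i) (2 ^ e i) (s (mate i) * x) =
    - (s i) * rescale (c i) (2 ^ e i) x.
    rewrite /s odd_mate signrN.
    by case: (odd i); rewrite ?expr0 ?expr1 ?opprK ?mulN1r ?mul1r ?rescaleN.
  rewrite signE rescaleD // mateK rescaleK //.
  have -> : (c i * c (mate i) = 2)%N by rewrite /c odd_mate; case: (odd i).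
  have ss : s i * s i = 1 by rewrite /s -expr2 sqrr_sign.
  rewrite FinRing.zmodVgE -[RHS]mul1r -ss; ring.
- apply/ffunP => i; rewrite !ffunE rescaleD // !FinRing.zmodMgE; ring.
by rewrite inE.
Qed.
End CyclicProduct.

(** * Realization of unit groups *)

Section Realization.
Local Open Scope group_scope.

Lemma has_turn_realization (K : finGroupType) :
  abelian [set: K] -> has_turn [set: K] ->
  exists A : comUnitRingType,
    char_zero A /\ group_isomorphic (unit_group A) ('Z_4 * K)%type.
Proof.
move=> cK [J [JM _ JK]].
have mulC (x y : K) : x * y = y * x by apply: (centsP cK); rewrite inE.
have M : {morph J : x y / x * y} by move=> x y; apply: JM; rewrite inE.
have V x : J (J x) = x^-1 by apply: JK; rewrite inE.
exact: (turned_group_realization (TurnedGroup mulC M V)).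
Qed.

Lemma realization_with_Z4 (K : finGroupType) :
  abelian [set: K] -> has_turn [set: K] ->
  exists A : comUnitRingType,
    char_zero A /\ group_isomorphic (unit_group A) ('Z_4 * ('Z_4 * K))%type.
Proof.
move=> cK turnK; have [A [A0 uA]] := has_turn_realization cK turnK.
exists (A * gaussint)%type; split; first exact: prod_char_zero.
apply: group_isomorphic_trans (prod_units _ _) _.
apply: group_isomorphic_trans (group_isomorphic_prod uA gaussint_units) _.
exact: group_isomorphic_prodC.
Qed.

End Realization.

Local Open Scope group_scope.

Theorem proposition5p8 (H : finGroupType) :
  abelian [set: H] ->
  (forall (p : nat) (Hp : {group H}),
      prime p -> (p = 3 %[mod 4])%N -> p.-Sylow([set: H]) Hp ->
      exists G : finGroupType, Hp \isog [set: (G * G)%type]) ->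
  (forall H2 : {group H}, 2.-Sylow([set: H]) H2 ->
      exists (r : nat) (e : nat -> nat),
        paired_exponents r e /\
        (H2 \isog [set: cyclic_product r e] \/
         H2 \isog [set: ('Z_4 * cyclic_product r e)%type])) ->
  exists A : comUnitRingType,
    char_zero A /\ group_isomorphic (unit_group A) ('Z_4 * H)%type.
Proof.
move=> cH squareH twoH.
have nilH : nilpotent [set: H] := abelian_nil cH.
have sylO p : p.-Sylow([set: H]) 'O_p([set: H]) := nilpotent_pcore_Hall p nilH.
have cO pi : abelian 'O_pi([set: H]) := abelianS (pcore_sub _ _) cH.
have turn_odd p : prime p -> p != 2 -> has_turn 'O_p([set: H]).
  move=> pr_p p2.
  have [p1|p3] : (p = 1 %[mod 4])%N \/ (p = 3 %[mod 4])%N.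
    by case: (even_prime pr_p) p2 => [->|odd_p _] //; lia.
    exact: has_turn_pgroup1 pr_p p1 (pcore_pgroup _ _) (cO _).
  have [G isoG] := squareH p _ pr_p p3 (sylO p).
  apply: (has_turn_isog isoG); apply: has_turn_square.
  have cGG : abelian [set: (G * G)%type] by rewrite -(isog_abelian isoG) cO.
  apply/centsP => x _ y _.
  by have [] : commute ((x, 1) : G * G) (y, 1)
    by apply: (centsP cGG); rewrite inE.
have [r [e [er [isoP|isoP]]]] := twoH _ (sylO 2).
  apply: has_turn_realization => //; apply: has_turn_pcores => // p pr_p.
  have [->|] := eqVneq p 2; last exact: turn_odd.
  exact: has_turn_isog isoP (has_turn_cyclic_product er).
pose S := 'O_2^'([set: H])%G.
pose K : finGroupType := (cyclic_product r e * subg_of S)%type.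
have isoH : [set: H] \isog [set: ('Z_4 * cyclic_product r e * subg_of S)%type].
  have defH := nilpotent_pcoreC 2 nilH.
  have := setX_dprod [set: ('Z_4 * cyclic_product r e)%type]%G
                     [set: subg_of S]%G.
  have -> : setX [set: ('Z_4 * cyclic_product r e)%type] [set: subg_of S]
      = [set: _].
    by apply/setP => x; rewrite !inE.
  move=> defL; apply: (isog_dprod defH defL).
    exact: isog_trans isoP (isog_setX1 _ _).
  exact: isog_trans (isog_subg S) (isog_set1X _ _).
have cK : abelian [set: K].
  pose L : finGroupType := ('Z_4 * cyclic_product r e * subg_of S)%type.
  have cL : abelian [set: L] by rewrite -(isog_abelian isoH).
  apply/centsP => -[p s] _ [p' s'] _.
  have comm : commute ((1, p, s) : L) (1, p', s').
    by apply: (centsP cL); rewrite inE.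
  exact: (congr1 (fun u : L => (u.1.2, u.2)) comm).
have turnS : has_turn [set: subg_of S].
  apply: has_turn_isog (_ : has_turn S); first by rewrite isog_sym isog_subg.
  apply: has_turn_pcores; first exact: abelian_nil (cO _).
  exact: has_turn_pcore_p'core.
have turnK : has_turn [set: K].
  exact: has_turn_prod (has_turn_cyclic_product er) turnS.
have [A [A0 uA]] := realization_with_Z4 cK turnK; exists A; split=> //.
apply: group_isomorphic_trans uA _.
apply: group_isomorphic_prod; first by exists idfun; exists idfun.
apply/group_isomorphic_sym.
apply: group_isomorphic_trans (isog_group_isomorphic isoH) _.
exact: group_isomorphic_prodA.
Qed.
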